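(* Let $p(t,h)=t+h^\alpha$ where $\alpha>1$. Then Weierstrass' continuous and nowhere differentiable function $$f(x)=\sum_{n=0}^\infty b^n\cos(a^n\pi x),$$ where $0<b<1$, $a$ is a positive integer, and $$\sqrt[\alpha]{a}\;b>1+\frac32\,\pi,$$ is nowhere $p$-differentiable on $\mathbb{R}$.
   Context: A function $f:\mathbb{R}\to\mathbb{R}$ is $p$-differentiable at $x\in\mathbb{R}$ if $$D_pf(x)=\lim_{h\to0}\frac{f(p(x,h))-f(x)}{h}$$ exists and is finite; here $h$ ranges over those real $h\neq0$ near $0$ for which $h^\alpha$ is defined as a real number (in particular all small $h>0$). Nowhere $p$-differentiable on $\mathbb{R}$ means not $p$-differentiable at any $x\in\mathbb{R}$. *)

(* Defs.v *)
From HB Require Import structures.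
From mathcomp Require Import all_boot all_order all_algebra.
From mathcomp Require Import all_classical all_reals all_analysis.

Set Implicit Arguments.
Unset Strict Implicit.
Unset Printing Implicit Defensive.

Import Order.TTheory GRing.Theory Num.Theory.
Import numFieldNormedType.Exports.

Local Open Scope classical_set_scope.
Local Open Scope ring_scope.

(* For a partial p, [dom x] is the set of h at which p(x, h) is defined; the
   values of [p x] outside [dom x] are irrelevant. *)
Definition is_p_derivative (R : realType) (dom : R -> set R) (p : R -> R -> R)
    (f : R -> R) (x l : R) : Prop :=
  (f (p x h) - f x) / h @[h --> within (dom x) 0^'] --> l.

Definition p_differentiable (R : realType) (dom : R -> set R) (p : R -> R -> R)
    (f : R -> R) (x : R) : Prop :=
  exists l : R, is_p_derivative dom p f x l.

Definition nowhere_p_differentiable (R : realType) (dom : R -> set R)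
    (p : R -> R -> R) (f : R -> R) : Prop :=
  forall x : R, ~ p_differentiable dom p f x.

(* A negative h has a real power h^alpha exactly when alpha = m / n with n odd;
   then h^alpha = (-1)^m |h|^alpha. The fraction need not be reduced: with n
   odd, the parity of m depends only on alpha. *)
Definition odd_denominator (R : realType) (alpha : R) : Prop :=
  exists (m : int) (n : nat), odd n /\ alpha = m%:~R / n%:R.

Definition even_over_odd (R : realType) (alpha : R) : Prop :=
  exists (m : int) (n : nat),
    [/\ ~~ odd `|m|%N, odd n & alpha = m%:~R / n%:R].

Definition rpow_defined (R : realType) (h alpha : R) : Prop :=
  [\/ 0 < h, h = 0 /\ 0 < alpha | h < 0 /\ odd_denominator alpha].

(* The library's [powR] is not the real power at a negative base. *)
Definition rpow (R : realType) (h alpha : R) : R :=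
  if 0 <= h then h `^ alpha
  else if `[< even_over_odd alpha >] then (- h) `^ alpha
  else - ((- h) `^ alpha).

Definition p_pow_dom (R : realType) (alpha : R) (t : R) : set R :=
  [set h | rpow_defined h alpha].

Definition p_pow (R : realType) (alpha : R) (t h : R) : R := t + rpow h alpha.

Definition weierstrass (R : realType) (a : nat) (b : R) (x : R) : R :=
  limn (series (fun n : nat => b ^+ n * cos (a%:R ^+ n * pi * x))).

(* Main.v *)
Require Import Defs.
From HB Require Import structures.
From mathcomp Require Import all_boot all_order all_algebra.
From mathcomp Require Import all_classical all_reals all_analysis.
From mathcomp Require Import ring lra.

(** At every scale [a ^- m] the function [f = weierstrass a b] has, just to the
right of any given point [x], an oscillation of size [b ^+ m]. To see it, pick
[y] with [x < y <= x + 2 a ^- m] and [a ^+ m * y] an even integer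
([exists_even_multiple_right]) and compare [f y] with [f (y + a ^- m)]. The
terms of index [n >= m] all attain their maximum [b ^+ n] at [y], so none of
them contributes negatively to [f y - f (y + a ^- m)], and the term of index
[m] contributes [2 b ^+ m], since the shift moves its argument by [pi]. As
cosine is 1-Lipschitz, the terms of index [n < m] change by at most
[pi a ^- m (a b) ^+ n] each, in total by at most
[pi / (a b - 1) * b ^+ m <= 2 / 3 * b ^+ m] ([weierstrass_head_bound]). Hence
the difference is at least [b ^+ m] ([weierstrass_drop]).

A finite p-derivative at [x], on the other hand, forces
[|f (x + k) - f x| <= M k `^ alpha^-1] for small [k > 0]
([p_derivative_right_holder]: substitute [k = h `^ alpha]). Since [y] and
[y + a ^- m] lie within [3 a ^- m] of [x], this makes the oscillation
[O(c ^- m)], where [c] is the [alpha]-th root of [a]. So [(c b) ^+ m] would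
stay bounded, whereas [c b > 1].

An even integer is chosen for [a ^+ m * y] because it stays even when multiplied
by powers of [a], whatever the parity of [a]; this is why all the higher terms
peak at [y] together. *)

Set Implicit Arguments.
Unset Strict Implicit.
Unset Printing Implicit Defensive.

Import Order.TTheory GRing.Theory Num.Theory.
Import numFieldNormedType.Exports.

Local Open Scope classical_set_scope.
Local Open Scope ring_scope.

Section Weierstrass.
Context {R : realType}.
Implicit Types (x y b : R) (a m n : nat) (z : int).

Lemma cos_lipschitz x y : `|cos x - cos y| <= `|x - y|.
Proof.
wlog xy : x y / y <= x.
  move=> W; have [/W//|/ltW/W] := leP y x.
  by rewrite distrC (distrC y).
have dcos t : t \in `]y, x[ -> is_derive t 1 (@cos R) (- sin t).
  by move=> _; exact: is_derive_cos.
have [|c _ ->] := MVT_segment xy dcos.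
  by apply: continuous_subspaceT => t; exact: continuous_cos.
by rewrite normrM ler_piMl// normrN sin_max.
Qed.

Lemma cos_int2pi z : cos (z%:~R * (pi *+ 2)) = 1 :> R.
Proof.
have cosn n : cos (n%:R * (pi *+ 2)) = 1 :> R.
  rewrite mulr_natl -[RHS](cos0 R) -(periodicn (@cosD2pi R) n 0).
  by rewrite add0r.
case: (intP z) => [|n|n]; first by rewrite mul0r cos0.
  exact: cosn.
by rewrite intrN mulNr cosN; exact: cosn.
Qed.

Lemma is_cvg_weierstrass a b x : 0 < b -> b < 1 ->
  cvgn (series (fun n => b ^+ n * cos (a%:R ^+ n * pi * x))).
Proof.
move=> b0 b1; apply: normed_cvg.
apply: (@series_le_cvg _ _ (geometric 1 b)) => [n|n|n|] /=.
- exact: normr_ge0.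
- by rewrite mul1r exprn_ge0// ltW.
- rewrite mul1r normrM ger0_norm ?exprn_ge0 ?(ltW b0)//.
  by rewrite ler_piMr ?exprn_ge0 ?(ltW b0)// cos_max.
- by apply: is_cvg_geometric_series; rewrite ger0_norm// ltW.
Qed.

(** The terms below the scale of the shift are controlled by the Lipschitz bound
alone; their slopes [b ^+ n * a%:R ^+ n * pi] grow geometrically, so the sum is
comparable to its last term. *)
Lemma weierstrass_head_bound a b m y : (0 < a)%N -> 0 < b -> 1 < a%:R * b ->
  - (pi / (a%:R * b - 1) * b ^+ m) <=
  \sum_(0 <= n < m) (b ^+ n * cos (a%:R ^+ n * pi * y) -
                     b ^+ n * cos (a%:R ^+ n * pi * (y + a%:R ^- m))).
Proof.
move=> a0 b0 q1; set q := a%:R * b in q1 *; set d := a%:R ^- m.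
have A0 : 0 < a%:R :> R by rewrite ltr0n.
have d0 : 0 < d by rewrite invr_gt0 exprn_gt0.
have dq : d * q ^+ m = b ^+ m.
  by rewrite /d /q exprMn mulKf// expf_neq0// gt_eqF.
have S : \sum_(0 <= n < m) q ^+ n <= q ^+ m / (q - 1).
  rewrite ler_pdivlMr ?subr_gt0// big_mkord mulrC -subrX1.
  by rewrite gerBl ler01.
(* The factor [d] of the Lipschitz bound turns [q ^+ m] into [b ^+ m]. *)
rewrite -dq; apply: (@le_trans _ _ (- (pi * d * \sum_(0 <= n < m) q ^+ n))).
  rewrite lerN2 (_ : pi / _ * _ = pi * d * (q ^+ m / (q - 1))); last by ring.
  by rewrite ler_wpM2l// mulr_ge0 ?pi_ge0// ltW.
rewrite mulr_sumr -sumrN; apply: ler_sum => n _.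
rewrite -mulrBr.
have := cos_lipschitz (a%:R ^+ n * pi * y) (a%:R ^+ n * pi * (y + d)).
rewrite -[X in _ <= `|X|]mulrBr opprD addrA subrr sub0r mulrN.
rewrite normrN [X in _ <= X]ger0_norm; last first.
  by rewrite !mulr_ge0 ?pi_ge0 ?exprn_ge0 ?(ltW d0) ?(ltW A0).
rewrite ler_norml => /andP[lb _].
rewrite (_ : - _ = b ^+ n * - (a%:R ^+ n * pi * d)); last first.
  by rewrite /q exprMn; ring.
by rewrite ler_wpM2l// exprn_ge0// ltW.
Qed.

(** Here [y] is a common peak of all the terms of index [n >= m], as
[a%:R ^+ n * y] is then an even integer for each of them. *)
Lemma weierstrass_drop a b m y z :
    (0 < a)%N -> 0 < b -> b < 1 -> 1 + 3 / 2 * pi < a%:R * b ->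
    a%:R ^+ m * y = z%:~R * 2 ->
  b ^+ m <= weierstrass a b y - weierstrass a b (y + a%:R ^- m).
Proof.
move=> a0 b0 b1 hab hy.
have piR : 0 < pi :> R by exact: pi_gt0.
have cvy := @is_cvg_weierstrass a b y b0 b1.
have cvy' := @is_cvg_weierstrass a b (y + a%:R ^- m) b0 b1.
rewrite /weierstrass -limB//; apply: limr_ge; first exact: is_cvgB.
near=> N.
have mN : (m < N)%N by near: N; exact: nbhs_infty_gt.
rewrite /= /series/= fctE -sumrB (@big_cat_nat _ _ _ m) ?(ltnW mN)//=.
have A0 : a%:R != 0 :> R by rewrite pnatr_eq0 -lt0n.
have peak n : (m <= n)%N -> cos (a%:R ^+ n * pi * y) = 1.
  move=> mn; rewrite -[RHS](cos_int2pi ((a ^ (n - m))%N%:Z * z)) intrM.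
  have -> : a%:R ^+ n = a%:R ^+ (n - m) * a%:R ^+ m :> R.
    by rewrite -exprD subnK.
  congr cos; rewrite -!mulrA (mulrCA _ pi) hy -pmulrn natrX.
  by ring.
rewrite (@big_ltn _ _ _ m)// peak//.
have -> : cos (a%:R ^+ m * pi * (y + a%:R ^- m)) = -1.
  rewrite mulrDr (mulrAC _ pi (_ ^-1)) mulfV ?mul1r ?expf_neq0//.
  by rewrite cosDpi peak.
(* [2 / 3] comes from [pi / (a b - 1) < 2 / 3], which is the hypothesis on [a b]. *)
have head : - (2 / 3 * b ^+ m) <= \sum_(0 <= n < m) (b ^+ n * cos (a%:R ^+ n * pi * y) -
                     b ^+ n * cos (a%:R ^+ n * pi * (y + a%:R ^- m))).
  apply: le_trans (weierstrass_head_bound _ _ a0 b0 _); last by lra.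
  rewrite lerN2 ler_wpM2r ?exprn_ge0 ?(ltW b0)//.
  by rewrite ler_pdivrMr; lra.
have tail : 0 <= \sum_(m.+1 <= n < N) (b ^+ n * cos (a%:R ^+ n * pi * y) -
                     b ^+ n * cos (a%:R ^+ n * pi * (y + a%:R ^- m))).
  rewrite big_nat_cond; apply: sumr_ge0 => n /andP[/andP[/ltnW mn _] _].
  by rewrite peak// -mulrBr mulr_ge0 ?exprn_ge0 ?(ltW b0).
have bm : 0 <= b ^+ m by rewrite exprn_ge0// ltW.
by lra.
Unshelve. all: by end_near. Qed.

Lemma exists_even_multiple_right x d : 0 < d ->
  exists y z, [/\ y = d * (z%:~R * 2), x < y & y <= x + 2 * d].
Proof.
move=> d0; pose t := x / (2 * d).
have xE : x = t * (2 * d) by rewrite divfK// gt_eqF// mulr_gt0.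
have /andP[tl tr] := floor_itv t.
exists (d * ((Num.floor t + 1)%:~R * 2)), (Num.floor t + 1); split => //.
  by rewrite xE; nra.
by move: tl; rewrite xE intrD mulr1z => tl; nra.
Qed.

(** Restricted to [h > 0] the map [h |-> h `^ alpha] is a bijection onto the
positive reals, so boundedness of the p-difference quotient near [0] becomes a
one-sided Hoelder condition of exponent [alpha^-1] at [x]. *)
Lemma p_derivative_right_holder (alpha x l : R) (f : R -> R) : 0 < alpha ->
    is_p_derivative (p_pow_dom alpha) (p_pow alpha) f x l ->
  exists M e, [/\ 0 < M, 0 < e & forall k, 0 < k -> k < e ->
    `|f (x + k) - f x| <= M * k `^ alpha^-1].
Proof.
move=> al0 /(cvgr_norm_lt) /(_ (`|l| + 1)); rewrite ltrDl ltr01 => /(_ isT).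
rewrite near_withinE => /nbhs_normP[e /= e0 he].
exists (`|l| + 1), (e `^ alpha); split; [by rewrite ltr_wpDl|exact: powR_gt0|].
move=> k k0 ke; set h := k `^ alpha^-1.
have h0 : 0 < h by exact: powR_gt0.
have hk : rpow h alpha = k.
  by rewrite /rpow ltW// -powRrM mulVf ?gt_eqF// powRr1// ltW.
have he' : h < e.
  rewrite /h -[ltRHS](@powRr1 _ e) ?ltW// -(@mulfV _ alpha) ?gt_eqF// powRrM.
  by rewrite gt0_ltr_powR ?invr_gt0// ?nnegrE ?powR_ge0// ltW.
have := he h; rewrite /= sub0r normrN gtr0_norm// => /(_ he').
rewrite gt_eqF// => /(_ isT) /(_ (Or31 _ _ h0)).
rewrite /p_pow hk normrM normfV (gtr0_norm h0) ltr_pdivrMr// => /ltW.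
by [].
Qed.

End Weierstrass.

Theorem theorem5p3 (R : realType) (alpha b : R) (a : nat)
    (alpha_gt1 : 1 < alpha) (b_gt0 : 0 < b) (b_lt1 : b < 1) (a_gt0 : (0 < a)%N)
    (hab : a%:R `^ alpha^-1 * b > 1 + 3 / 2 * pi) :
  nowhere_p_differentiable (p_pow_dom alpha) (p_pow alpha) (weierstrass a b).
Proof.
move=> x [l /p_derivative_right_holder].
have al0 : 0 < alpha by rewrite (lt_trans ltr01).
move=> /(_ al0)[M [e [M0 e0 fM]]].
have piR : 0 < pi :> R by exact: pi_gt0.
set beta := alpha^-1 in hab fM.
have be0 : 0 < beta by rewrite invr_gt0.
have be1 : beta <= 1 by rewrite invf_le1// ltW.
have a1 : 1 <= a%:R :> R by rewrite ler1n.
set c := a%:R `^ beta in hab.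
have ca : c <= a%:R by rewrite -[leRHS]powRr1// ler_powR.
have c0 : 0 < c by apply: powR_gt0; rewrite ltr0n.
have q1 : 1 < c * b by lra.
have ab : 1 + 3 / 2 * pi < a%:R * b.
  by apply: (lt_le_trans hab); rewrite ler_wpM2r// ltW.
have a_gt1 : 1 < a%:R :> R by nra.
(* Both the scale [a ^- m] and the ratio [(c b) ^- m] must eventually be small. *)
have small (r u : R) : 1 < r -> 0 < u -> \forall m \near \oo, r ^- m < u.
  move=> r1 u0; have r0 : 0 < r by rewrite (lt_trans ltr01).
  have := @cvg_expr R r^-1.
  rewrite ger0_norm ?invr_ge0 ?(ltW r0)// invf_lt1// => /(_ r1).
  move=> /cvgr_lt /(_ _ u0); apply: filterS => m.
  by rewrite exprVn.
near \oo => m.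
have dm : a%:R ^- m < e / 3 :> R.
  by near: m; apply: small; rewrite ?divr_gt0.
have qm : (c * b) ^- m < (6 * M)^-1.
  by near: m; apply: small; rewrite ?invr_gt0 ?mulr_gt0.
set d : R := a%:R ^- m in dm.
have d0 : 0 < d by rewrite invr_gt0 exprn_gt0// (lt_trans ltr01).
have [y [z [yE xy yx]]] := exists_even_multiple_right x d0.
have amy : a%:R ^+ m * y = z%:~R * 2.
  by rewrite yE /d mulVKf// expf_neq0// gt_eqF// (lt_trans ltr01).
have drop := weierstrass_drop a_gt0 b_gt0 b_lt1 ab amy.
(* The constant uses [3 `^ beta <= 3], valid because [beta <= 1]. *)
have close k : 0 < k -> k <= 3 * d ->
    `|weierstrass a b (x + k) - weierstrass a b x| <= M * (3 * c ^- m).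
  move=> k0 kd; apply: (le_trans (fM _ k0 _)); first by lra.
  rewrite ler_wpM2l ?(ltW M0)//.
  have -> : c ^- m = d `^ beta.
    by rewrite /d -!powR_invn ?(ltW c0)// powRAC.
  apply: (@le_trans _ _ ((3 * d) `^ beta)).
    by rewrite ge0_ler_powR ?nnegrE ?(ltW k0) ?(ltW be0) ?mulr_ge0 ?(ltW d0).
  rewrite powRM ?(ltW d0)// ler_wpM2r ?powR_ge0//.
  by rewrite -[leRHS]powRr1// ler_powR// ler1n.
have := close (y - x); have := close (y + d - x).
rewrite !(addrC x) !subrK => /(_ _ _)/ler_normlP H1 /(_ _ _)/ler_normlP H2.
have [h1 _] := H1 ltac:(lra) ltac:(lra).
have [_ h2] := H2 ltac:(lra) ltac:(lra).
(* [6 = 2 * 3]: two increments, each bounded with the constant [3 * M]. *)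
have cm : b ^+ m <= 6 * M * c ^- m by lra.
move: qm; rewrite ltNge => /negP; apply.
rewrite -[leLHS]mul1r ler_pdivrMr ?mulr_gt0// exprMn invfM.
rewrite mulrAC ler_pdivlMr ?exprn_gt0// mul1r; lra.
Unshelve. all: by end_near. Qed.
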